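(* The chordal $\rightarrow$ co-chain problem can be solved in polynomial time: given a chordal graph $G$, a minimum set $V_-\subseteq V(G)$ such that $G - V_-$ is a co-chain graph can be computed in polynomial time.
   Context: All graphs are finite, simple and undirected. A graph is chordal if every cycle of length greater than three has a chord. A chain graph is a bipartite graph containing no induced $2K_2$ (two disjoint edges with no edges between them). A co-chain graph is the complement of a chain graph; equivalently, a graph with no induced $I_3$ (independent set of size 3), $C_4$, or $C_5$. *)

(* Defs.v *)
From mathcomp Require Import all_boot all_algebra.

Set Implicit Arguments.
Unset Strict Implicit.
Unset Printing Implicit Defensive.

Record sgraph := SGraph {
  svertex :> finType;
  sedge : rel svertex;
  sedge_sym : symmetric sedge;
  sedge_irrefl : irreflexive sedge
}.

Arguments sedge {s} x y.

Section Graphs.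

Variable G : sgraph.

Definition compl_rel : rel G := fun x y => (x != y) && ~~ sedge x y.

Lemma compl_rel_sym : symmetric compl_rel.
Proof. by move=> x y; rewrite /compl_rel eq_sym sedge_sym. Qed.

Lemma compl_rel_irrefl : irreflexive compl_rel.
Proof. by move=> x; rewrite /compl_rel eqxx. Qed.

Definition compl : sgraph := SGraph compl_rel_sym compl_rel_irrefl.

Variable S : {set G}.

Definition del_rel : rel {x : G | x \notin S} :=
  fun x y => sedge (val x) (val y).

Lemma del_rel_sym : symmetric del_rel.
Proof. by move=> x y; apply: sedge_sym. Qed.

Lemma del_rel_irrefl : irreflexive del_rel.
Proof. by move=> x; apply: sedge_irrefl. Qed.

Definition del_vertices : sgraph := SGraph del_rel_sym del_rel_irrefl.

(* A chord of a cycle c is an edge joining two vertices of c that are not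
   consecutive on c. *)
Definition has_chord (c : seq G) : Prop :=
  exists x y : G, [/\ x \in c, y \in c, sedge x y,
                      y != next c x & x != next c y].

Definition chordal : Prop :=
  forall c : seq G, ucycle sedge c -> 3 < size c -> has_chord c.

Definition bipartite : Prop :=
  exists A : {set G}, forall x y : G, sedge x y -> (x \in A) != (y \in A).

Definition has_induced_2K2 : Prop :=
  exists a b c d : G,
    [/\ uniq [:: a; b; c; d], sedge a b, sedge c d &
        [/\ ~~ sedge a c, ~~ sedge a d, ~~ sedge b c & ~~ sedge b d]].

Definition chain_graph : Prop := bipartite /\ ~ has_induced_2K2.

End Graphs.

Definition cochain_graph (G : sgraph) : Prop := chain_graph (compl G).

Definition deletion_set (B : sgraph -> Prop) (G : sgraph) (S : {set G}) : Prop :=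
  B (del_vertices S).

Definition minimum_deletion_set (B : sgraph -> Prop) (G : sgraph)
    (S : {set G}) : Prop :=
  deletion_set B S /\ forall S' : {set G}, deletion_set B S' -> #|S| <= #|S'|.

(* Random access machines in the style of Cook and Reckhow, with registers
   X_0, X_1, ... holding natural numbers, a read-only input tape and a
   write-only output tape.  Each instruction costs one step.  As there is no
   multiplication, the largest number stored gains at most one bit per step
   (up to a constant depending on the program), so that polynomial time on these
   machines is polynomial time on Turing machines. *)
Inductive instr : Type :=
| Const of nat & nat          (* X_i := c *)
| Add of nat & nat & nat      (* X_i := X_j + X_k *)
| Monus of nat & nat & nat    (* X_i := X_j - X_k, truncated at 0 *)
| LoadInd of nat & nat        (* X_i := X_(X_j) *)
| StoreInd of nat & nat       (* X_(X_i) := X_j *)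
| Jump of nat & nat           (* if X_i > 0 then go to instruction m *)
| Read of nat                 (* X_i := next input number, 0 if none is left *)
| Print of nat.               (* append X_i to the output *)

Definition program := seq instr.

Record config := Config {
  pc : nat;
  reg : nat -> nat;
  inp : seq nat;
  out : seq nat
}.

Definition upd (f : nat -> nat) (i v : nat) : nat -> nat :=
  fun k => if k == i then v else f k.

Definition exec (a : instr) (s : config) : config :=
  let: Config q r u w := s in
  match a with
  | Const i c => Config q.+1 (upd r i c) u w
  | Add i j k => Config q.+1 (upd r i (r j + r k)) u w
  | Monus i j k => Config q.+1 (upd r i (r j - r k)) u w
  | LoadInd i j => Config q.+1 (upd r i (r (r j))) u w
  | StoreInd i j => Config q.+1 (upd r (r i) (r j)) u w
  | Jump i m => Config (if 0 < r i then m else q.+1) r u w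
  | Read i => Config q.+1 (upd r i (head 0 u)) (behead u) w
  | Print i => Config q.+1 r u (rcons w (r i))
  end.

(* The machine has halted once the program counter is past the program; a
   halted configuration is a fixed point of [step]. *)
Definition halted (P : program) (s : config) : bool := size P <= pc s.

Definition step (P : program) (s : config) : config :=
  if onth P (pc s) is Some a then exec a s else s.

Definition init (u : seq nat) : config := Config 0 (fun=> 0) u [::].

(* On input u, P halts after at most t steps with output w. *)
Definition computes_within (P : program) (u w : seq nat) (t : nat) : Prop :=
  let s := iter t (step P) (init u) in halted P s /\ out s = w.

(* The number of vertices followed by the adjacency matrix, row by row. *)
Definition graph_code (n : nat) (e : rel 'I_n) : seq nat :=
  n :: [seq nat_of_bool (e i j) | i <- enum 'I_n, j <- enum 'I_n].

(* The elements of S in increasing order. *)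
Definition set_code (n : nat) (S : {set 'I_n}) : seq nat :=
  [seq val i | i <- enum S].

(* The A -> B problem (given G in A, find a minimum S such that G - S is in B)
   is solved by a machine in time polynomial in the number of vertices of G. *)
Definition polytime_deletion (A B : sgraph -> Prop) : Prop :=
  exists (P : program) (p : {poly nat}),
    forall (n : nat) (e : rel 'I_n)
           (e_sym : symmetric e) (e_irrefl : irreflexive e),
      let G := SGraph e_sym e_irrefl in
      A G ->
      exists S : {set 'I_n},
        minimum_deletion_set B (G := G) S /\
        computes_within P (graph_code e) (set_code S) (p.[n])%R.

(* Main.v *)
Require Import Defs.
From mathcomp Require Import all_boot all_algebra.
From mathcomp Require Import zify.

Set Implicit Arguments.
Unset Strict Implicit.
Unset Printing Implicit Defensive.

(** A chordal graph has no induced 4-cycle, so its induced co-chain subgraphs are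
    exactly those whose vertices are covered by two cliques.  By Dirac's theorem
    the vertices can be eliminated one after the other, each being simplicial
    when it goes; every clique lies in the closed neighbourhood of its first
    eliminated vertex v, restricted to the vertices not eliminated before v, and
    these n sets are themselves cliques.  Hence the largest union of two of them
    is the largest induced co-chain subgraph, and its complement is the answer.

    The algorithm is written in a small language whose only loops run over
    0, ..., n-1, so that every program is total and has a polynomial running time
    that can be read off its syntax; expressions contain sums over 0, ..., n-1,
    which give bounded quantifiers, multiplication by n and minimisation. *)

(** * Simplicial vertices of chordal graphs *)

Lemma next_inner (T : eqType) (x u v : T) l1 l2 :
  uniq (x :: l1 ++ u :: v :: l2) -> next (x :: l1 ++ u :: v :: l2) u = v.
Proof.
move=> Ul; rewrite next_nth inE mem_cat mem_head !orbT /=.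
have xu : x == u = false.
  by apply: contraTF Ul => /eqP->; rewrite /= mem_cat mem_head orbT.
have ul1 : u \notin l1.
  by move: Ul; rewrite /= cat_uniq /= negb_or => /and5P [_ _ /andP [->]].
rewrite xu index_cat (negbTE ul1) /= eqxx addn0.
by rewrite nth_cat ltnNge leqnSn /= subSn // subnn.
Qed.

Lemma next_last (T : eqType) (x u : T) l :
  uniq (x :: rcons l u) -> next (x :: rcons l u) u = x.
Proof.
move=> Ul; rewrite next_nth inE mem_rcons mem_head !orbT /=.
have xu : x == u = false.
  by apply: contraTF Ul => /eqP->; rewrite /= mem_rcons mem_head.
have ul1 : u \notin l by move: Ul; rewrite /= rcons_uniq => /and3P [].
rewrite xu -cats1 index_cat (negbTE ul1) /= eqxx.
by rewrite nth_default // size_cat /= addn0 addn1.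
Qed.

Section Dirac.

Variable G : sgraph.
Hypothesis chG : chordal G.

Definition simplicial (U : {set G}) (s : G) : Prop :=
  {in U &, forall a b, sedge s a -> sedge s b -> a != b -> sedge a b}.

(* A shortest such detour from a to b would close up with x to a chordless
   cycle. *)
Lemma detour_edge (x a b : G) (l : seq G) :
  sedge x a -> sedge x b -> a != b ->
  uniq l -> sorted sedge l -> head x l = a -> last x l = b ->
  {in l, forall z, z != x /\ (sedge x z -> z = a \/ z = b)} ->
  sedge a b.
Proof.
move=> xa xb ab; have [m] := ubnP (size l).
elim: m l => // m IH l ltlm Ul Sl hl ll Nx.
(* A path on at most two vertices is the edge itself, as [a] differs from [x] and from [b]. *)
have [l2|l2] := leqP (size l) 2.
  case: l hl ll Sl Ul l2 {ltlm IH Nx} => [|c [|d [|//]]] /=.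
  - by move=> ax _; rewrite -ax sedge_irrefl in xa.
  - by move=> ca cb; rewrite -ca -cb eqxx in ab.
  - by move=> -> ->; rewrite andbT.
have xl : x \notin l by apply/negP => /Nx [/eqP].
have Uc : uniq (x :: l) by rewrite /= xl.
have Cc : cycle sedge (x :: l).
  case: l hl ll Sl l2 {IH ltlm Ul Nx xl Uc} => [|c l] //= -> ll Sl _.
  by rewrite rcons_path xa Sl ll sedge_sym.
have [|//|u [v [uc vc uv vnu unv]]] := chG (c := x :: l).
  by apply/andP; split.
have lastl : exists l', l = rcons l' b.
  case/lastP: (l) ll l2 => [|l' c] //; rewrite last_rcons => -> _.
  by exists l'.
have headl : exists l', l = a :: l'.
  by case: (l) hl l2 => [|c l'] // /= -> _; exists l'.
(* A chord inside the path skips at least one vertex, since [v'] does not follow [u'] on the cycle;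
   the shortcut is a shorter detour. *)
have key u' v' l1 l2' : l = l1 ++ u' :: l2' -> v' \in l2' -> sedge u' v' ->
    v' != next (x :: l) u' -> sedge a b.
  move=> El v'l u'v'; case/path.splitPr: v'l El => l3 l4.
  case: l3 => [|c l3] El.
    by rewrite {1}El next_inner ?eqxx // -?El.
  move=> _; have El' : subseq (l1 ++ u' :: v' :: l4) l.
    rewrite El; apply: cat_subseq => //=; rewrite eqxx.
    by apply: (@cat_subseq _ [::] (v' :: l4) (c :: l3)).
  apply: (IH (l1 ++ u' :: v' :: l4)).
  - rewrite ltnS in ltlm; apply: leq_trans ltlm.
    by rewrite El !size_cat /= size_cat ltn_add2l !ltnS leq_addl.
  - exact: subseq_uniq El' Ul.
  - move: Sl; rewrite El !sorted_cat_cons => /andP [-> ].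
    by rewrite cat_path /= => /and3P [_ _ ->]; rewrite u'v'.
  - by rewrite -hl El; case: (l1).
  - by rewrite -ll El !last_cat /= last_cat /=.
  - by move=> z zl; apply: Nx; apply: mem_subseq El' _ zl.
(* No chord ends at [x]: its only neighbours on the path are [a] and [b], which are consecutive to
   it on the cycle. *)
have keyx v' : sedge x v' -> v' \in l -> v' != next (x :: l) x ->
    x != next (x :: l) v' -> sedge a b.
  move=> xv' /Nx [_ /(_ xv')]; case=> ->.
    by case: headl => l' ->; rewrite /= eqxx eqxx.
  by case: lastl => l' El; rewrite El next_last ?eqxx // -El.
case: (eqVneq u x) uc => [ux _|ux].
  case: (eqVneq v x) vc => [vx _|vx].
    by rewrite ux vx sedge_irrefl in uv.
  rewrite inE (negbTE vx) /= => vl.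
  by rewrite ux in uv vnu unv; apply: (keyx v).
rewrite inE (negbTE ux) /= => ul.
case: (eqVneq v x) vc => [vx _|vx].
  by rewrite vx sedge_sym in uv vnu unv; apply: (keyx u).
rewrite inE (negbTE vx) /= => vl.
case/path.splitPr El: _ / ul => [l1 l3].
move: vl; rewrite El mem_cat inE => /or3P [vl1|/eqP vu|vl3].
- case/path.splitPr El1: _ / vl1 => [l4 l5].
  apply: (key v u l4 (l5 ++ u :: l3)) => //.
  + by rewrite El El1 -catA.
  + by rewrite mem_cat mem_head orbT.
  + by rewrite sedge_sym.
- by rewrite vu sedge_irrefl in uv.
- exact: (key u v l1 l3).
Qed.

(** Asking for a simplicial vertex away from a prescribed [x] makes the induction on the size of [U]
    work. A component of the non-neighbours of [x], together with its boundary, is a smaller set; a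
    vertex of the component has all its neighbours from [U] in that set, so being simplicial there
    suffices. *)
Lemma simplicial_nonneighbour (U : {set G}) (x y : G) :
  x \in U -> y \in U -> y != x -> ~~ sedge x y ->
  exists s, [/\ s \in U, s != x, ~~ sedge x s & simplicial U s].
Proof.
have [m] := ubnP #|U|; elim: m U x y => // m IH U x y ltm xU yU yx xy.
pose D := [set z in U | (z != x) && ~~ sedge x z].
pose rD : rel G := fun u v => [&& u \in D, v \in D & sedge u v].
pose C := [set z | connect rD y z].
have yD : y \in D by rewrite inE yU yx.
have symD : symmetric rD by move=> u v; rewrite /rD sedge_sym andbCA.
have CD : {subset C <= D}.
  move=> z; rewrite inE => /connectP [p pp ->].
  elim: p y yD pp {yU yx xy C} => //= c p IHp y yD /andP [/and3P [_ cD _]].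
  exact: IHp.
have DU z : z \in D -> [/\ z \in U, z != x & ~~ sedge x z].
  by rewrite inE => /and3P.
have yC : y \in C by rewrite inE connect0.
have C_step c z : c \in C -> z \in D -> sedge c z -> z \in C.
  move=> cC zD cz; have cD := CD _ cC.
  move: cC; rewrite !inE => /connect_trans; apply; apply: connect1.
  by rewrite /rD cD zD.
(* C is a component of the non-neighbours of x in U, and S its boundary. *)
pose S := [set z in U | (z \notin C) && [exists c in C, sedge c z]].
have Sx z : z \in S -> z != x /\ sedge x z.
  rewrite inE => /and3P [zU zC /exists_inP [c cC cz]].
  have [_ _ xc] := DU _ (CD _ cC).
  have zx : z != x by apply: contraNneq xc => <-; rewrite sedge_sym.
  split=> //; apply: contraNT zC => xz; apply: C_step cC _ cz.
  by rewrite inE zU zx xz.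
(* Two boundary vertices are joined by a walk whose inner vertices are not adjacent to [x]; once
   shortened to a path, [detour_edge] applies. *)
have S_clique : {in S &, forall a b, a != b -> sedge a b}.
  move=> a b aS bS ab.
  have [ax xa] := Sx _ aS; have [bx xb] := Sx _ bS.
  move: aS bS; rewrite !inE => /and3P [aU aC /exists_inP [c cC ca]].
  move=> /and3P [bU bC /exists_inP [d dC db]].
  have /connectP [p pp dp] : connect rD c d.
    apply: (connect_trans (y := y)).
      by rewrite (sym_connect_sym symD); rewrite inE in cC.
    by rewrite inE in dC.
  have pD : {subset c :: p <= D}.
    move: (CD _ cC) pp; elim: (p) (c) => [|c' p' IHp] c0 /= c0D.
      by move=> _ z; rewrite inE => /eqP->.
    move=> /andP [/and3P [_ c'D _]] /IHp; move=> /(_ c'D) sub z.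
    by rewrite inE => /predU1P [->|/sub].
  have pa : path sedge a (rcons (c :: p) b).
    rewrite rcons_path /= sedge_sym ca /= -dp db andbT.
    by apply: sub_path pp => u v /and3P [].
  have Eb : b = last a (rcons (c :: p) b) by rewrite last_rcons.
  have Np : {in a :: rcons (c :: p) b,
      forall z, z != x /\ (sedge x z -> z = a \/ z = b)}.
    move=> z; rewrite inE mem_rcons inE.
    move=> /or3P [/eqP->|/eqP->|/pD /DU [_ zx xz]].
    - by split=> // _; left.
    - by split=> // _; right.
    - by split=> // /(elimN idP xz).
  case/shortenP: pa Eb => q pq Uq sq Eb.
  apply: (@detour_edge x a b (a :: q)) => //.
  by move=> z; rewrite inE => /predU1P [->|/sq zq]; apply: Np;
    rewrite inE ?eqxx ?zq ?orbT.
pose W := C :|: S.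
have WU : {subset W <= U}.
  by move=> z /setUP [/CD/DU[]|] //; rewrite inE => /andP [].
have xW : x \notin W.
  by apply/negP => /setUP [/CD/DU[]|/Sx []]; rewrite eqxx.
have ltW : #|W| < m.
  rewrite ltnS in ltm; apply: leq_trans ltm; apply: proper_card.
  apply/properP; split; first exact/subsetP.
  by exists x.
suff [s sC simW] : exists2 s, s \in C & simplicial W s.
  have [sU sx xs] := DU _ (CD _ sC); exists s; split=> // a b aU bU sa sb.
  have NW z : z \in U -> sedge s z -> z \in W.
    move=> zU sz; rewrite in_setU; have [//|zC /=] := boolP (z \in C).
    by rewrite inE zU zC; apply/exists_inP; exists s.
  by apply: simW => //; apply: NW.
(* The induction hypothesis gives a simplicial vertex of [W] not adjacent to [z]. It is not in [S],
   because either alternative of the last premise makes [z] adjacent to every other vertex of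
   [S]. *)
have far_in_C z : z \in W ->
    (exists2 y', y' \in W & (y' != z) && ~~ sedge z y') ->
    (z \in S \/ {in S & W, forall u v, u != v -> sedge u v}) ->
    exists2 s, s \in C & simplicial W s.
  move=> zW [y' y'W /andP [y'z zy']] zS.
  have [s [sW sz zs simW]] := IH W z y' ltW zW y'W y'z zy'.
  exists s => //; move: sW => /setUP [//|sS]; case: zS => [zS|univ].
    by rewrite S_clique // eq_sym in zs.
  by rewrite sedge_sym univ in zs.
(* Three cases: some vertex of [S] has a non-neighbour in [W]; none has, but some vertex of [W]
   does; or [W] is a clique and [y] itself serves. *)
have [/exists_inP [z zS zy]|noS] :=
    boolP [exists z in S, [exists y' in W, (y' != z) && ~~ sedge z y']].
  have zW : z \in W by rewrite in_setU zS orbT.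
  by apply: (far_in_C z zW); [apply/exists_inP | left].
have univ : {in S & W, forall u v, u != v -> sedge u v}.
  move=> u v uS vW uv; apply: contraNT noS => Nuv.
  apply/exists_inP; exists u => //; apply/exists_inP.
  by exists v; rewrite // eq_sym uv.
have [/exists_inP [z zW zy]|noW] :=
    boolP [exists z in W, [exists y' in W, (y' != z) && ~~ sedge z y']].
  by apply: (far_in_C z zW); [apply/exists_inP | right].
exists y => // a b aW bW _ _ ab; apply: contraNT noW => Nab.
apply/exists_inP; exists a => //; apply/exists_inP.
by exists b; rewrite // eq_sym ab.
Qed.

Lemma exists_simplicial (U : {set G}) :
  U != set0 -> exists2 s, s \in U & simplicial U s.
Proof.
case/set0Pn=> z zU.
have [/exists_inP [x xU /exists_inP [y yU /andP [yx xy]]]|noU] :=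
    boolP [exists x in U, [exists y in U, (y != x) && ~~ sedge x y]].
  by have [s [sU _ _ simU]] := simplicial_nonneighbour xU yU yx xy; exists s.
exists z => // a b aU bU _ _ ab; apply: contraNT noU => Nab.
apply/exists_inP; exists a => //; apply/exists_inP.
by exists b; rewrite // eq_sym ab.
Qed.

End Dirac.

(** * Co-chain subgraphs and cliques *)

Definition clique (G : sgraph) (A : {set G}) : Prop :=
  {in A &, forall a b, a != b -> sedge a b}.

(** The colour classes of the bipartite complement are independent there, hence cliques in the graph
    itself. *)
Lemma deletion_set_cliques (G : sgraph) (S : {set G}) :
  deletion_set cochain_graph S ->
  exists A B : {set G}, [/\ clique A, clique B & ~: S = A :|: B].
Proof.
case=> [[A bipA] _].
have edge (x y : {x : G | x \notin S}) :
    (x \in A) = (y \in A) -> x != y -> sedge (val x) (val y).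
  move=> Axy xy; apply: contraT => Nxy.
  by have := bipA x y; rewrite Axy eqxx; apply; rewrite /= /compl_rel xy.
exists [set val x | x in A], [set val x | x in ~: A]; split.
- move=> _ _ /imsetP [x xA ->] /imsetP [y yA ->] xy.
  by apply: edge; [rewrite xA yA | apply: contraNneq xy => ->].
- move=> _ _ /imsetP [x xA ->] /imsetP [y yA ->] xy.
  rewrite !inE in xA yA.
  by apply: edge; [rewrite (negbTE xA) (negbTE yA) | apply: contraNneq xy => ->].
- apply/setP => x; rewrite !inE; apply/idP/orP.
    move=> xS; case: (boolP ((Sub x xS : {x : G | x \notin S}) \in A)) => xA.
      by left; apply/imsetP; exists (Sub x xS).
    by right; apply/imsetP; exists (Sub x xS); rewrite ?inE.
  by case=> /imsetP [y _ ->]; exact: (valP y).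
Qed.

Lemma chordal_no_C4 (G : sgraph) (a b c d : G) :
  chordal G -> uniq [:: a; b; c; d] ->
  sedge a b -> sedge b c -> sedge c d -> sedge d a ->
  ~~ sedge a c -> ~~ sedge b d -> False.
Proof.
move=> chG Uabcd ab bc cd da ac bd.
have [|//|x [y [xc yc xy]]] := chG [:: a; b; c; d].
  by rewrite /ucycle Uabcd /= ab bc cd da.
move: Uabcd; rewrite /= !inE !negb_or.
move=> /and4P [/and3P [nab nac nad] /andP [nbc nbd] ncd _].
have [nba nca nda ncb] :
    [/\ b == a = false, c == a = false, d == a = false & c == b = false].
  by split; rewrite eq_sym; apply: negbTE.
have [ndb ndc] : d == b = false /\ d == c = false.
  by split; rewrite eq_sym; apply: negbTE.
(* Of the sixteen pairs, diagonals are non-edges by hypothesis, sides are consecutive on the cycle,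
   and equal ends contradict irreflexivity. *)
move: xc yc xy; rewrite !inE => /or4P [] /eqP-> /or4P [] /eqP->.
all: rewrite ?sedge_irrefl ?(negbTE ac) ?(negbTE bd) //.
all: try by rewrite sedge_sym ?(negbTE ac) ?(negbTE bd).
all: by rewrite /= ?eqxx ?(negbTE nab) ?(negbTE nac) ?nba ?nca ?nda ?ncb ?ndb
  ?ndc /= ?eqxx.
Qed.

(* In a chordal graph the second condition on co-chain graphs is automatic: an
   induced 2K_2 of the complement is an induced 4-cycle. *)
Lemma cliques_deletion_set (G : sgraph) (S A B : {set G}) :
  chordal G -> clique A -> clique B -> ~: S \subset A :|: B ->
  deletion_set cochain_graph S.
Proof.
move=> chG cA cB /subsetP sub; split.
  exists [set x | val x \in A] => x y /=; rewrite /compl_rel /= /del_rel !inE.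
  move=> /andP [xy]; apply: contraNneq => Axy.
  have {}xy : val x != val y by apply: contraNneq xy => /val_inj->.
  have [xA|xA] := boolP (val x \in A); first by apply: cA; rewrite // -Axy.
  have inB z : z \notin S -> z \notin A -> z \in B.
    by move=> zS zA; move: (sub z); rewrite !inE zS (negbTE zA) => /(_ isT).
  by apply: cB => //; apply: inB; rewrite ?(valP x) ?(valP y) // -Axy.
case=> a [b [c [d [Uabcd /= ab cd [ac ad bc bd]]]]].
move: ab cd ac ad bc bd; rewrite /compl_rel /= /del_rel.
move: Uabcd; rewrite /= !inE !negb_or.
move=> /and4P [/and3P [nab nac nad] /andP [nbc nbd] ncd _].
rewrite nab nac nad nbc nbd ncd /= !negbK => ab cd ac ad bc bd.
have vne (x y : {x : G | x \notin S}) : x != y -> val x != val y.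
  by apply: contraNneq => /val_inj->.
(* The two complement edges, [a] to [b] and [c] to [d], become the diagonals of the cycle [a], [c],
   [b], [d]. *)
apply: (@chordal_no_C4 _ (val a) (val c) (val b) (val d) chG) => //.
  rewrite -[X in uniq X]/(map val [:: a; c; b; d]) (map_inj_uniq val_inj) /= !inE.
  by rewrite !negb_or nac nab nad eq_sym nbc ncd nbd.
by rewrite sedge_sym.
by rewrite sedge_sym.
Qed.

(** * A loop language and its compilation to random access machines *)

Inductive exp : Type :=
| EVar of nat
| ENum of nat
| EAdd of exp & exp
| ESub of exp & exp
| EArr of bool & exp
| ESum of nat & exp.

Inductive cmd : Type :=
| CAsg of nat & exp
| CStore of bool & exp & exp
| CSeq of cmd & cmd
| CIf of exp & cmd
| CFor of nat & cmd
| CRead of nat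
| CPrint of exp.

Record state := State {
  vars : nat -> nat;
  arrs : bool -> nat -> nat;
  input : seq nat;
  output : seq nat
}.

Definition set_var (s : state) (x v : nat) : state :=
  State (upd (vars s) x v) (arrs s) (input s) (output s).

Definition set_arr (s : state) (a : bool) (i v : nat) : state :=
  State (vars s) (fun b => if b == a then upd (arrs s b) i v else arrs s b)
    (input s) (output s).

Fixpoint eval (n : nat) (vs : nat -> nat) (ar : bool -> nat -> nat) (e : exp)
    : nat :=
  match e with
  | EVar x => vs x
  | ENum c => c
  | EAdd e1 e2 => eval n vs ar e1 + eval n vs ar e2
  | ESub e1 e2 => eval n vs ar e1 - eval n vs ar e2
  | EArr a e1 => ar a (eval n vs ar e1)
  | ESum x e1 => \sum_(i < n) eval n (upd vs x i) ar e1
  end.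

Fixpoint sem (n : nat) (c : cmd) (s : state) : state :=
  match c with
  | CAsg x e => set_var s x (eval n (vars s) (arrs s) e)
  | CStore a e1 e2 =>
      set_arr s a (eval n (vars s) (arrs s) e1) (eval n (vars s) (arrs s) e2)
  | CSeq c1 c2 => sem n c2 (sem n c1 s)
  | CIf e c1 => if 0 < eval n (vars s) (arrs s) e then sem n c1 s else s
  | CFor x c1 => iteri n (fun i s' => sem n c1 (set_var s' x i)) s
  | CRead x =>
      State (upd (vars s) x (head 0 (input s))) (arrs s) (behead (input s))
        (output s)
  | CPrint e =>
      State (vars s) (arrs s) (input s)
        (rcons (output s) (eval n (vars s) (arrs s) e))
  end.

(** Step bounds for the compiled code, as polynomials in n. For [ESum], a round adds 2 steps of test
    and 3 of bookkeeping to the body; the 10 is made of 6 steps of set-up, 2 for the failing test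
    and 2 to restore the variable. *)
Fixpoint ecost (e : exp) : {poly nat} :=
  (match e with
  | EVar x => 2%:P
  | ENum c => 1%:P
  | EAdd e1 e2 | ESub e1 e2 => ecost e1 + ecost e2 + 1%:P
  | EArr a e1 => ecost e1 + 5%:P
  | ESum x e1 => (ecost e1 + 5%:P) * 'X + 10%:P
  end)%R.

(** In [CFor], the 6 covers the test, the loading of the variable and the increment of the counter,
    two steps each; the 5 covers three steps of set-up and the failing test. *)
Fixpoint ccost (c : cmd) : {poly nat} :=
  (match c with
  | CAsg x e => ecost e + 2%:P
  | CStore a e1 e2 => ecost e1 + ecost e2 + 5%:P
  | CSeq c1 c2 => ccost c1 + ccost c2
  | CIf e c1 => ecost e + ccost c1 + 3%:P
  | CFor x c1 => (ccost c1 + 6%:P) * 'X + 5%:P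
  | CRead x => 1%:P
  | CPrint e => ecost e + 1%:P
  end)%R.

(* Register 0 holds the number of vertices; the residues modulo 4 keep the
   variables, temporaries and the two arrays disjoint. *)
Definition var_reg (x : nat) : nat := 4 * x + 4.
Definition tmp_reg (d : nat) : nat := 4 * d + 1.
(** Two doublings and the addition of a constant: the form in which compiled code computes the
    address. *)
Definition arr_reg (a : bool) (i : nat) : nat := i + i + (i + i) + (2 + a).

(** The value goes to temporary [d], and the temporaries below [d] survive. Jump targets are
    absolute, hence the address [q] of the first instruction. A copy is made by clearing the target
    and adding to it. *)
Fixpoint compile_exp (d q : nat) (e : exp) : program :=
  match e with
  | EVar x => [:: Const (tmp_reg d) 0; Add (tmp_reg d) (tmp_reg d) (var_reg x)]
  | ENum c => [:: Const (tmp_reg d) c]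
  | EAdd e1 e2 =>
      let p1 := compile_exp d q e1 in
      let p2 := compile_exp d.+1 (q + size p1) e2 in
      p1 ++ p2 ++ [:: Add (tmp_reg d) (tmp_reg d) (tmp_reg d.+1)]
  | ESub e1 e2 =>
      let p1 := compile_exp d q e1 in
      let p2 := compile_exp d.+1 (q + size p1) e2 in
      p1 ++ p2 ++ [:: Monus (tmp_reg d) (tmp_reg d) (tmp_reg d.+1)]
  | EArr a e1 =>
      compile_exp d q e1 ++
      [:: Add (tmp_reg d) (tmp_reg d) (tmp_reg d);
          Add (tmp_reg d) (tmp_reg d) (tmp_reg d);
          Const (tmp_reg d.+1) (2 + a);
          Add (tmp_reg d) (tmp_reg d) (tmp_reg d.+1);
          LoadInd (tmp_reg d) (tmp_reg d)]
  | ESum x e1 =>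
      let body := compile_exp d.+2 (q + 6) e1 in
      let test := q + 6 + (size body + 3) in
      (* temporary d.+1 saves the value of x *)
      [:: Const (tmp_reg d) 0;
          Const (tmp_reg d.+1) 0;
          Add (tmp_reg d.+1) (tmp_reg d.+1) (var_reg x);
          Const (var_reg x) 0;
          (* Jumping on the constant 1 is unconditional; the loop is entered at its test, so that no
             round runs when n = 0. *)
          Const (tmp_reg d.+2) 1;
          Jump (tmp_reg d.+2) test] ++
      (body ++
       [:: Add (tmp_reg d) (tmp_reg d) (tmp_reg d.+2);
           Const (tmp_reg d.+2) 1;
           Add (var_reg x) (var_reg x) (tmp_reg d.+2)]) ++
      (* Operand 0 is the register holding n: the difference is positive exactly while [x] is below
         n. *)
      [:: Monus (tmp_reg d.+2) 0 (var_reg x);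
          Jump (tmp_reg d.+2) (q + 6);
          Const (var_reg x) 0;
          Add (var_reg x) (var_reg x) (tmp_reg d.+1)]
  end.

Fixpoint compile (d q : nat) (c : cmd) : program :=
  match c with
  | CAsg x e =>
      compile_exp d q e ++
      [:: Const (var_reg x) 0; Add (var_reg x) (var_reg x) (tmp_reg d)]
  | CStore a e1 e2 =>
      let p1 := compile_exp d q e1 in
      let p2 := compile_exp d.+1 (q + size p1) e2 in
      p1 ++ p2 ++
      [:: Add (tmp_reg d) (tmp_reg d) (tmp_reg d);
          Add (tmp_reg d) (tmp_reg d) (tmp_reg d);
          Const (tmp_reg d.+2) (2 + a);
          Add (tmp_reg d) (tmp_reg d) (tmp_reg d.+2);
          StoreInd (tmp_reg d) (tmp_reg d.+1)]
  | CSeq c1 c2 =>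
      let p1 := compile d q c1 in
      p1 ++ compile d (q + size p1) c2
  | CIf e c1 =>
      let p1 := compile_exp d q e in
      let body := compile d (q + size p1 + 3) c1 in
      p1 ++
      (* A positive condition skips the unconditional jump past the body. *)
      [:: Jump (tmp_reg d) (q + size p1 + 3);
          Const (tmp_reg d) 1;
          Jump (tmp_reg d) (q + size p1 + 3 + size body)] ++
      body
  | CFor x c1 =>
      let body := compile d.+1 (q + 5) c1 in
      (* the counter is temporary d: the body may overwrite x *)
      [:: Const (tmp_reg d) 0;
          Const (tmp_reg d.+1) 1;
          Jump (tmp_reg d.+1) (q + 5 + (size body + 2));
          Const (var_reg x) 0;
          Add (var_reg x) (var_reg x) (tmp_reg d)] ++
      (body ++
       [:: Const (tmp_reg d.+1) 1;
           Add (tmp_reg d) (tmp_reg d) (tmp_reg d.+1)]) ++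
      [:: Monus (tmp_reg d.+1) 0 (tmp_reg d);
          Jump (tmp_reg d.+1) (q + 3)]
  | CRead x => [:: Read (var_reg x)]
  | CPrint e => compile_exp d q e ++ [:: Print (tmp_reg d)]
  end.

(** * Correctness and running time of the compiled code *)

Section Correctness.

Variable P : program.

Definition run (s s' : config) (t : nat) : Prop :=
  exists2 t', t' <= t & iter t' (step P) s = s'.

Lemma run_trans s2 s1 s3 t1 t2 :
  run s1 s2 t1 -> run s2 s3 t2 -> run s1 s3 (t1 + t2).
Proof.
case=> k1 le1 E1 [k2 le2 E2]; exists (k2 + k1); first by rewrite addnC leq_add.
by rewrite iterD E1.
Qed.

Lemma run_leq s s' t t' : run s s' t -> t <= t' -> run s s' t'.
Proof. by case=> k lek E le; exists k => //; apply: leq_trans le. Qed.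

Lemma run_pc s q q' r u w t :
  run s (Config q r u w) t -> q = q' -> run s (Config q' r u w) t.
Proof. by move=> ? <-. Qed.

Definition code_at (q : nat) (cs : program) : Prop :=
  forall k, k < size cs -> onth P (q + k) = onth cs k.

Lemma code_at_eq q q' cs : code_at q cs -> q = q' -> code_at q' cs.
Proof. by move=> ? <-. Qed.

Lemma code_at_cat q c1 c2 :
  code_at q (c1 ++ c2) -> code_at q c1 /\ code_at (q + size c1) c2.
Proof.
move=> H; split=> k ltk.
  by rewrite H ?size_cat ?ltn_addr // onth_cat ltk.
by rewrite -addnA H ?size_cat ?ltn_add2l // onth_cat ltnNge leq_addr addKn.
Qed.

(** Without jumps the program counter only advances, so the run is a fold that simplification
    evaluates on concrete blocks. *)
Lemma run_block q cs r u w :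
  code_at q cs -> all (fun a => if a is Jump _ _ then false else true) cs ->
  run (Config q r u w) (foldl (fun s a => exec a s) (Config q r u w) cs)
    (size cs).
Proof.
elim: cs q r u w => [|a cs IH] q r u w H; first by exists 0.
have [H1 H2] := @code_at_cat q [:: a] cs H.
have Ea : onth P q = Some a by have := H1 0 isT; rewrite addn0.
move=> /= /andP [na ncs]; rewrite -[(size cs).+1]add1n.
apply: (@run_trans (exec a (Config q r u w))).
  by exists 1 => //=; rewrite /step /= Ea.
rewrite addn1 in H2.
by case: a na {H H1 Ea} => //= *; apply: IH.
Qed.

Lemma run_jump q i m cs r u w :
  code_at q (Jump i m :: cs) ->
  run (Config q r u w) (Config (if 0 < r i then m else q.+1) r u w) 1.
Proof.
by move=> /(_ 0 isT); rewrite addn0 => E; exists 1 => //=; rewrite /step /= E.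
Qed.

Lemma upd_same r i v : upd r i v i = v.
Proof. by rewrite /upd eqxx. Qed.

Lemma run_test q t y z m cs r u w :
  code_at q [:: Monus t y z, Jump t m & cs] ->
  run (Config q r u w)
    (Config (if r z < r y then m else q + 2) (upd r t (r y - r z)) u w) 2.
Proof.
move=> H; have [H1 H2] := @code_at_cat q [:: _] _ H.
apply: (run_trans (run_block r u w H1 isT)).
have := run_jump (upd r t (r y - r z)) u w H2.
by rewrite upd_same subn_gt0 /= addn1 addn2.
Qed.

(** Residues modulo 4 separate temporaries, variables and arrays; register 0 has the residue of the
    variables but lies below them. *)
Lemma updE r :
  (forall i v, upd r i v i = v) *
  (forall d v, upd r (tmp_reg d) v 0 = r 0) *
  (forall d v x, upd r (tmp_reg d) v (var_reg x) = r (var_reg x)) *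
  (forall d v a i, upd r (tmp_reg d) v (arr_reg a i) = r (arr_reg a i)) *
  (forall x v, upd r (var_reg x) v 0 = r 0) *
  (forall x v d, upd r (var_reg x) v (tmp_reg d) = r (tmp_reg d)) *
  (forall x v a i, upd r (var_reg x) v (arr_reg a i) = r (arr_reg a i)) *
  (forall a i v, upd r (arr_reg a i) v 0 = r 0) *
  (forall a i v d, upd r (arr_reg a i) v (tmp_reg d) = r (tmp_reg d)) *
  (forall a i v x, upd r (arr_reg a i) v (var_reg x) = r (var_reg x)) *
  (forall d v, upd r (tmp_reg d.+1) v (tmp_reg d) = r (tmp_reg d)) *
  (forall d v, upd r (tmp_reg d.+2) v (tmp_reg d) = r (tmp_reg d)) *
  (forall d v, upd r (tmp_reg d) v (tmp_reg d.+1) = r (tmp_reg d.+1)) *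
  (forall d v, upd r (tmp_reg d) v (tmp_reg d.+2) = r (tmp_reg d.+2)).
Proof.
rewrite /upd /tmp_reg /var_reg /arr_reg.
by do !split; move=> *; (case: eqP => //; lia).
Qed.

Variable n : nat.

(** Temporaries are left out of this relation; [same_tmps] records which of them a piece of code
    preserves. *)
Definition represents (vs : nat -> nat) (ar : bool -> nat -> nat)
    (r : nat -> nat) : Prop :=
  [/\ r 0 = n, forall x, r (var_reg x) = vs x &
      forall a i, r (arr_reg a i) = ar a i].

Lemma represents_tmp vs ar r d v :
  represents vs ar r -> represents vs ar (upd r (tmp_reg d) v).
Proof. by case=> r0 rv ra; split=> *; rewrite updE. Qed.

Lemma represents_var vs ar r x v :
  represents vs ar r -> represents (upd vs x v) ar (upd r (var_reg x) v).
Proof.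
case=> r0 rv ra; split=> *; rewrite ?updE // /upd -rv.
by rewrite /var_reg eqn_add2r eqn_pmul2l.
Qed.

Lemma represents_arr vs ar r a i v :
  represents vs ar r ->
  represents vs (fun b => if b == a then upd (ar b) i v else ar b)
    (upd r (arr_reg a i) v).
Proof.
case=> r0 rv ra; split=> [|x|b j]; rewrite ?updE //.
rewrite {1}/upd; have -> : (arr_reg b j == arr_reg a i) = (b == a) && (j == i).
  rewrite /arr_reg; apply/eqP/andP => [E|[/eqP-> /eqP->] //].
  by split; [case: (b) (a) E => [] [] //= | apply/eqP]; lia.
by case: (b == a); rewrite /= ?ra // /upd ra.
Qed.

Definition same_tmps d (r r' : nat -> nat) :=
  forall k, k < d -> r' (tmp_reg k) = r (tmp_reg k).

Lemma same_tmps_trans d r1 r2 r3 :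
  same_tmps d r1 r2 -> same_tmps d r2 r3 -> same_tmps d r1 r3.
Proof. by move=> H1 H2 k ltk; rewrite H2 // H1. Qed.

Lemma same_tmps_le d d' r r' : d <= d' -> same_tmps d' r r' -> same_tmps d r r'.
Proof. by move=> le H k ltk; apply/H/(leq_trans ltk). Qed.

Lemma same_tmps_tmp d d' r r' v :
  d <= d' -> same_tmps d r r' -> same_tmps d r (upd r' (tmp_reg d') v).
Proof.
move=> le H k ltk; rewrite -(H _ ltk) /upd /tmp_reg; case: eqP => //; lia.
Qed.

Lemma same_tmps_var d x r r' v :
  same_tmps d r r' -> same_tmps d r (upd r' (var_reg x) v).
Proof. by move=> H k ltk; rewrite updE H. Qed.

Lemma same_tmps_arr d a i r r' v :
  same_tmps d r r' -> same_tmps d r (upd r' (arr_reg a i) v).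
Proof. by move=> H k ltk; rewrite updE H. Qed.

Lemma represents_ext vs vs' ar r :
  vs =1 vs' -> represents vs ar r -> represents vs' ar r.
Proof. by move=> E [r0 rv ra]; split=> // x; rewrite rv. Qed.

(** By induction on [e]. A second operand is evaluated one temporary higher, so [same_tmps] keeps
    the first value intact. *)
Lemma compile_exp_correct e d q vs ar r u w :
  represents vs ar r -> code_at q (compile_exp d q e) ->
  exists r', [/\ represents vs ar r', same_tmps d r r',
    r' (tmp_reg d) = eval n vs ar e &
    run (Config q r u w) (Config (q + size (compile_exp d q e)) r' u w)
      (ecost e).[n]%R].
Proof.
elim: e d q vs r u w =>
  [x|c|e1 IH1 e2 IH2|e1 IH1 e2 IH2|a e IH|x e IH] d q vs r u w R /=.
- move=> H; exists (upd (upd r (tmp_reg d) 0) (tmp_reg d) (vs x)); split.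
  + by do 2!apply: represents_tmp.
  + by do 2!apply: same_tmps_tmp => //.
  + by rewrite updE.
  + have := run_block r u w H isT; rewrite /= !updE hornerC.
    by case: R => _ -> _; rewrite addn2.
- move=> H; exists (upd r (tmp_reg d) c); split.
  + exact: represents_tmp.
  + exact: same_tmps_tmp.
  + by rewrite updE.
  + by have := run_block r u w H isT; rewrite /= hornerC addn1.
- move=> /code_at_cat [H1 /code_at_cat [H2 H3]].
  have [r1 [R1 S1 E1 run1]] := IH1 _ _ _ _ u w R H1.
  have [r2 [R2 S2 E2 run2]] := IH2 _ _ _ _ u w R1 H2.
  exists (upd r2 (tmp_reg d) (eval n vs ar e1 + eval n vs ar e2)); split.
  + exact: represents_tmp.
  + by apply/same_tmps_tmp/(same_tmps_trans S1)/(same_tmps_le _ S2).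
  + by rewrite updE.
  + rewrite !hornerD hornerC; apply: run_trans (run_trans run1 run2) _.
    have := run_block r2 u w H3 isT; rewrite /= E2 S2 // E1.
    by rewrite !size_cat !addnA addn1.
- move=> /code_at_cat [H1 /code_at_cat [H2 H3]].
  have [r1 [R1 S1 E1 run1]] := IH1 _ _ _ _ u w R H1.
  have [r2 [R2 S2 E2 run2]] := IH2 _ _ _ _ u w R1 H2.
  exists (upd r2 (tmp_reg d) (eval n vs ar e1 - eval n vs ar e2)); split.
  + exact: represents_tmp.
  + by apply/same_tmps_tmp/(same_tmps_trans S1)/(same_tmps_le _ S2).
  + by rewrite updE.
  + rewrite !hornerD hornerC; apply: run_trans (run_trans run1 run2) _.
    have := run_block r2 u w H3 isT; rewrite /= E2 S2 // E1.
    by rewrite !size_cat !addnA addn1.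
- move=> /code_at_cat [H1 H2].
  have [r1 [R1 S1 E1 run1]] := IH _ _ _ _ u w R H1.
  have := run_block r1 u w H2 isT; rewrite /= !updE E1.
  set r2 := upd _ _ _ => run2; exists r2; split.
  + by rewrite /r2; do !apply: represents_tmp.
  + by rewrite /r2; do !apply: same_tmps_tmp => //.
  + by rewrite /r2 !updE; case: R1.
  + rewrite hornerD hornerC size_cat addnA; apply: run_trans run1 _.
    by rewrite -addn1 -addn4 -addnA in run2.
- set body := compile_exp _ _ _.
  move=> H; have [H1 H'] := @code_at_cat q [:: _; _; _; _; _] _ H.
  have [J1 /code_at_cat [/code_at_cat [H2 H3] H4]] := @code_at_cat _ [:: _] _ H'.
  set test := q + 6 + (size body + 3) in J1 *.
  have {}J1 := code_at_eq J1 (erefl (q + 5)).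
  have {}H2 : code_at (q + 6) body by apply: code_at_eq H2 _ => /=; lia.
  have {}H3 := @code_at_eq _ (q + 6 + size body) _ H3 ltac:(rewrite /=; lia).
  have {}H4 := @code_at_eq _ test _ H4 ltac:(rewrite /= size_cat /= /test; lia).
  (* After [i] rounds temporary [d] holds the partial sum and [d.+1] the saved value of [x]; the
     induction is on the number [m] of rounds left. *)
  have loop m i r1 : i + m = n -> represents (upd vs x i) ar r1 ->
      same_tmps d r r1 ->
      r1 (tmp_reg d) = \sum_(j < i) eval n (upd vs x j) ar e ->
      r1 (tmp_reg d.+1) = vs x ->
      exists r', [/\ represents (upd vs x n) ar r', same_tmps d r r',
        r' (tmp_reg d) = \sum_(j < n) eval n (upd vs x j) ar e,
        r' (tmp_reg d.+1) = vs x &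
        run (Config test r1 u w) (Config (test + 2) r' u w)
          (m * ((ecost e).[n]%R + 5) + 2)].
    elim: m i r1 => [|m IHm] i r1 Ei R1 S1 V1 V1'; have [r10 rv1 _] := R1.
      rewrite addn0 in Ei; subst i.
      have := run_test r1 u w H4; rewrite r10 rv1 upd_same ltnn.
      set r2 := upd _ _ _ => run1; exists r2; split=> //.
      - exact: represents_tmp.
      - by apply: same_tmps_tmp => //; rewrite !leqW.
      - by rewrite /r2 updE.
      - by rewrite /r2 updE.
    have := run_test r1 u w H4; rewrite r10 rv1 upd_same.
    rewrite -Ei -{1}(addn0 i) ltn_add2l ltn0Sn Ei.
    set r2 := upd _ _ _ => run1.
    have R2 : represents (upd vs x i) ar r2 by apply: represents_tmp.
    have [r3 [R3 S3 E3 run3]] := IH _ _ _ _ u w R2 H2.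
    have := run_block r3 u w H3 isT; rewrite /= !updE E3.
    have [_ rv3 _] := R3; rewrite rv3 upd_same.
    rewrite S3 // /r2 !updE V1.
    set r4 := upd _ _ _ => run4.
    have [|||||r' [R' S' E' E'' run']] := IHm i.+1 r4.
    - by rewrite addSnnS.
    - apply: represents_ext
        (represents_var x (i + 1) (represents_tmp _ _ (represents_tmp _ _ R3))).
      by move=> y; rewrite /upd addn1; case: eqP.
    - rewrite /r4; apply: same_tmps_var; do 2?[apply: same_tmps_tmp; first lia].
      apply: same_tmps_trans S1 _.
      apply: same_tmps_trans (same_tmps_le _ S3); last by rewrite !leqW.
      by rewrite /r2; apply: same_tmps_tmp; first lia.
    - by rewrite big_ord_recr /r4 /= !updE.
    - by rewrite /r4 !updE S3 // /r2 !updE.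
    exists r'; split=> //.
    have Et : (q + 6 + size body).+3 = test by rewrite /test; lia.
    rewrite Et in run4.
    apply: run_leq (run_trans (run_trans run1 run3) (run_trans run4 run')) _.
    lia.
  have := run_block r u w H1 isT; rewrite /= !updE add0n.
  have [_ -> _] := R; set r0 := upd _ (tmp_reg d.+2) 1.
  rewrite -[q.+1.+4]addn4 addSnnS => run1.
  have r01 : r0 (tmp_reg d.+2) = 1 by rewrite /r0 upd_same.
  have := run_jump r0 u w J1; rewrite r01 /= => run2.
  have [|||||r' [R' S' E' E'' run']] := loop n 0 r0.
  - by rewrite add0n.
  - by apply/represents_tmp/represents_var; do 3!apply: represents_tmp.
  - by do 5?[apply: same_tmps_tmp; first lia | apply: same_tmps_var].
  - by rewrite big_ord0 /r0 !updE.
  - by rewrite /r0 !updE.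
  have [H4' H5] := @code_at_cat _ [:: _; _] _ H4.
  have := run_block r' u w H5 isT; rewrite /= !updE E'' add0n.
  set r5 := upd _ _ _ => run5; exists r5; split.
  (* Restoring [x] from its saved value gives back [vs], up to pointwise equality. *)
  - apply: represents_ext (represents_var x (vs x) (represents_var x 0 R')).
    by move=> y; rewrite /upd; case: eqP => // ->.
  - by rewrite /r5; do 2!apply: same_tmps_var.
  - by rewrite /r5 !updE.
  have {}run2 := run_trans (run_trans run1 run2) (run_trans run' run5).
  rewrite hornerD hornerMX hornerD !hornerC size_cat /= size_cat /=.
  have -> : q + (size body + 3 + 4).+4.+2 = (test + 2).+2 by rewrite /test; lia.
  by apply: run_leq run2 _; lia.
Qed.

Lemma compile_correct c d q s r :
  represents (vars s) (arrs s) r -> code_at q (compile d q c) ->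
  let s' := sem n c s in
  exists r', [/\ represents (vars s') (arrs s') r', same_tmps d r r' &
    run (Config q r (input s) (output s))
      (Config (q + size (compile d q c)) r' (input s') (output s'))
      (ccost c).[n]%R].
Proof.
elim: c d q s r => [x e|a e1 e2|c1 IH1 c2 IH2|e c IH|x c IH|x|e] d q s r R /=.
- move=> /code_at_cat [H1 H2].
  have [r1 [R1 S1 E1 run1]] := compile_exp_correct (input s) (output s) R H1.
  have := run_block r1 (input s) (output s) H2 isT; rewrite /= !updE E1 add0n.
  set r2 := upd _ _ _ => run2; exists r2; split.
  + apply: represents_ext (represents_var x _ (represents_var x 0 R1)) => y.
    by rewrite /upd; case: eqP.
  + by do 2!apply: same_tmps_var.
  + rewrite hornerD hornerC size_cat; apply: run_trans run1 _.
    by rewrite addnA addn2.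
- move=> /code_at_cat [H1 /code_at_cat [H2 H3]].
  have [r1 [R1 S1 E1 run1]] := compile_exp_correct (input s) (output s) R H1.
  have [r2 [R2 S2 E2 run2]] := compile_exp_correct (input s) (output s) R1 H2.
  have := run_block r2 (input s) (output s) H3 isT; rewrite /= !updE E2 S2 // E1.
  set r3 := upd _ _ _ => run3; exists r3; split.
  + by apply: represents_arr; do 4!apply: represents_tmp.
  + apply: same_tmps_arr; do 4!(apply: same_tmps_tmp; first lia).
    by apply: same_tmps_trans S1 (same_tmps_le _ S2).
  + rewrite !hornerD hornerC.
    apply: run_pc (run_trans (run_trans run1 run2) run3) _.
    by rewrite !size_cat /=; lia.
- move=> /code_at_cat [H1 H2].
  have [r1 [R1 S1 run1]] := IH1 _ _ _ _ R H1.
  have [r2 [R2 S2 run2]] := IH2 _ _ _ _ R1 H2.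
  exists r2; split=> //; first exact: same_tmps_trans S1 S2.
  by rewrite hornerD size_cat addnA; apply: run_trans run1 run2.
- set p1 := compile_exp d q e; set body := compile _ _ _.
  move=> /code_at_cat [H1 H].
  have [J1 H'] := @code_at_cat _ [:: _] _ H.
  have [C2 H''] := @code_at_cat _ [:: _] _ H'.
  have [J2 H2] := @code_at_cat _ [:: _] _ H''.
  have {}H2 : code_at (q + size p1 + 3) body by apply: code_at_eq H2 _ => /=; lia.
  have [r1 [R1 S1 E1 run1]] := compile_exp_correct (input s) (output s) R H1.
  have := run_jump r1 (input s) (output s) J1; rewrite E1.
  have -> : q + size (p1 ++ [:: Jump (tmp_reg d) (q + size p1 + 3),
    Const (tmp_reg d) 1, Jump (tmp_reg d) (q + size p1 + 3 + size body) & body]) =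
    q + size p1 + 3 + size body by rewrite size_cat /=; lia.
  rewrite !hornerD !hornerC.
  case: ltnP => _ runJ.
    have [r2 [R2 S2 run2]] := IH _ _ _ _ R1 H2.
    exists r2; split=> //; first exact: same_tmps_trans S1 S2.
    by apply: run_leq (run_trans run1 (run_trans runJ run2)) _; lia.
  have run2 := run_block r1 (input s) (output s) C2 isT.
  have := run_jump (upd r1 (tmp_reg d) 1) (input s) (output s) J2.
  rewrite upd_same /= => run3; rewrite /= addn1 in run2; rewrite !addn1 in run3.
  exists (upd r1 (tmp_reg d) 1); split; first exact: represents_tmp.
    exact: same_tmps_tmp.
  apply: run_leq (run_trans (run_trans run1 runJ) (run_trans run2 run3)) _.
  by lia.
- set body := compile _ _ _; set f := fun i s' => sem n c (set_var s' x i).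
  move=> H; have [H1 H'] := @code_at_cat q [:: _; _] _ H.
  have [J1 H''] := @code_at_cat _ [:: _] _ H'.
  have [H2 /code_at_cat [/code_at_cat [H3 H4] H5]] := @code_at_cat _ [:: _; _] _ H''.
  set test := q + 5 + (size body + 2) in J1 *.
  have {}J1 := @code_at_eq _ q.+2 _ J1 ltac:(rewrite /=; lia).
  have {}H2 := @code_at_eq _ (q + 3) _ H2 ltac:(rewrite /=; lia).
  have {}H3 : code_at (q + 5) body by apply: code_at_eq H3 _ => /=; lia.
  have {}H4 := @code_at_eq _ (q + 5 + size body) _ H4 ltac:(rewrite /=; lia).
  have {}H5 := @code_at_eq _ test _ H5 ltac:(rewrite /= size_cat /= /test; lia).
  (* Again [m] rounds are left. The counter sits in temporary [d], which the body preserves because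
     it is compiled from [d.+1] on. *)
  have loop m i r1 : i + m = n ->
      let s1 := iteri i f s in let s2 := iteri n f s in
      represents (vars s1) (arrs s1) r1 -> same_tmps d r r1 ->
      r1 (tmp_reg d) = i ->
      exists r', [/\ represents (vars s2) (arrs s2) r', same_tmps d r r' &
        run (Config test r1 (input s1) (output s1))
          (Config (test + 2) r' (input s2) (output s2))
          (m * ((ccost c).[n]%R + 6) + 2)].
    elim: m i r1 => [|m IHm] i r1 Ei s1 s2 R1 S1 V1; have [r10 _ _] := R1.
      rewrite addn0 in Ei; rewrite /s1 Ei -/s2 in R1 *.
      have := run_test r1 (input s2) (output s2) H5.
      rewrite r10 V1 Ei ltnn.
      set r2 := upd _ _ _ => run1; exists r2; split=> //.
      - exact: represents_tmp.
      - by apply: same_tmps_tmp; first lia.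
    have := run_test r1 (input s1) (output s1) H5; rewrite r10 V1.
    rewrite -[X in _ < X]Ei -{1}(addn0 i) ltn_add2l ltn0Sn.
    set r2 := upd _ _ _ => run1.
    have V2 : r2 (tmp_reg d) = i by rewrite /r2 updE.
    have := run_block r2 (input s1) (output s1) H2 isT; rewrite /= !updE V2 add0n.
    have -> : (q + 3).+2 = q + 5 by lia.
    set r3 := upd _ _ _ => run2.
    have R3 : represents (vars (set_var s1 x i)) (arrs (set_var s1 x i)) r3.
      apply: represents_ext
        (represents_var x i (represents_var x 0 (represents_tmp _ _ R1))) => y.
      by rewrite /= /upd; case: eqP.
    have [r4 [R4 S4 run4]] := IH _ _ _ _ R3 H3.
    have V4 : r4 (tmp_reg d) = i by rewrite S4 // /r3 !updE.
    have := run_block r4 (input (f i s1)) (output (f i s1)) H4 isT.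
    rewrite /= !updE V4; set r5 := upd _ _ _ => run5.
    have Et : (q + 5 + size body).+2 = test by rewrite /test; lia.
    rewrite Et in run5.
    have [||||r' [R' S' run']] := IHm i.+1 r5.
    - by rewrite addSnnS.
    - by do 2!apply: represents_tmp.
    - rewrite /r5; do 2!(apply: same_tmps_tmp; first lia).
      apply: same_tmps_trans S1 _.
      apply: same_tmps_trans (same_tmps_le _ S4); last by rewrite leqW.
      by do 2!apply: same_tmps_var; apply: same_tmps_tmp; first lia.
    - by rewrite /r5 updE addn1.
    exists r'; split=> //.
    have run45 := run_trans (run_trans run1 run2) (run_trans run4 run5).
    by apply: run_leq (run_trans run45 run') _; lia.
  have := run_block r (input s) (output s) H1 isT; rewrite /=.
  set r0 := upd _ (tmp_reg d.+1) 1 => run1.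
  have r01 : r0 (tmp_reg d.+1) = 1 by rewrite /r0 upd_same.
  have := run_jump r0 (input s) (output s) J1; rewrite r01 /= => run2.
  have [||||r' [R' S' run']] := loop n 0 r0.
  + by rewrite add0n.
  + by do 2!apply: represents_tmp.
  + by do 2!(apply: same_tmps_tmp; first lia).
  + by rewrite /r0 !updE.
  exists r'; split=> //.
  rewrite hornerD hornerMX hornerD !hornerC /= size_cat /= size_cat /=.
  have -> : q + (size body + 2 + 2).+4.+1 = test + 2 by rewrite /test; lia.
  by apply: run_leq (run_trans (run_trans run1 run2) run') _; lia.
- move=> H; have := run_block r (input s) (output s) H isT => /= run1.
  exists (upd r (var_reg x) (head 0 (input s))); split.
  + exact: represents_var.
  + exact: same_tmps_var.
  + by rewrite hornerC addn1.
- move=> /code_at_cat [H1 H2].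
  have [r1 [R1 S1 E1 run1]] := compile_exp_correct (input s) (output s) R H1.
  have := run_block r1 (input s) (output s) H2 isT; rewrite /= E1 => run2.
  exists r1; split=> //; rewrite hornerD hornerC size_cat addnA addn1.
  exact: run_trans run1 run2.
Qed.

End Correctness.

(** The input starts with n, which the loop tests expect in register 0; the compiled code begins at
    address 1. *)
Definition machine (c : cmd) : program := Read 0 :: compile 0 1 c.

Lemma machine_correct c n l t :
  (1%:P + ccost c)%R.[n]%R <= t ->
  computes_within (machine c) (n :: l)
    (output (sem n c (State (fun=> 0) (fun _ _ => 0) l [::]))) t.
Proof.
rewrite hornerD hornerC => le_t; set s := State _ _ _ _.
have H : code_at (machine c) 1 (compile 0 1 c) by move=> k _; rewrite add1n.
have R : represents n (vars s) (arrs s) (upd (fun=> 0) 0 n).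
  split=> [|x|a i]; rewrite /upd ?eqxx // /var_reg /arr_reg.
    by case: eqP => //; lia.
  by case: eqP => //; lia.
have [r' [_ _ run1]] := compile_correct R H.
have run0 :
    run (machine c) (init (n :: l)) (Config 1 (upd (fun=> 0) 0 n) l [::]) 1.
  by exists 1.
have [k lek E] := run_leq (run_trans run0 run1) le_t.
rewrite /computes_within -(subnK lek) iterD E.
set s' := Config _ _ _ _.
have halt : halted (machine c) s' by rewrite /halted /= add1n.
(* A halted configuration is a fixed point, so the [t - k] steps to spare change nothing. *)
have -> : iter (t - k) (step (machine c)) s' = s'.
  by elim: (t - k) => //= j ->; rewrite /step onth_default.
by [].
Qed.

(** * The algorithm *)

(* A number is read as a truth value: positive means true. *)
Definition ENot (e : exp) : exp := ESub (ENum 1) e.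
Definition EOr (e1 e2 : exp) : exp := EAdd e1 e2.
Definition EAnd (e1 e2 : exp) : exp := ENot (EOr (ENot e1) (ENot e2)).
Definition ELe (e1 e2 : exp) : exp := ENot (ESub e1 e2).
Definition EEq (e1 e2 : exp) : exp := EAnd (ELe e1 e2) (ELe e2 e1).
Definition EEx (x : nat) (e : exp) : exp := ESum x e.
Definition EAll (x : nat) (e : exp) : exp := ENot (EEx x (ENot e)).
(* The least y satisfying e is the number of those x such that no y <= x
   satisfies e. *)
Definition EMin (x y : nat) (e : exp) : exp :=
  ESum x (ENot (EEx y (EAnd (ELe (EVar y) (EVar x)) e))).

(* The adjacency matrix is stored row by row; the sum over variable 0 is the
   product of n and the row index. *)
Definition EAdj (x y : nat) : exp :=
  EArr false (EAdd (ESum 0 (EVar x)) (EVar y)).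
Definition EPos (x : nat) : exp := EArr true (EVar x).
Definition EAlive (x : nat) : exp := ENot (EPos x).
Definition ESimplicial : exp :=
  EAll 3 (EAll 4 (EOr (ENot (EAnd (EAnd (EAlive 3) (EAlive 4))
                                  (EAnd (EAdj 8 3) (EAdj 8 4))))
                      (EOr (EEq (EVar 3) (EVar 4)) (EAdj 3 4)))).
Definition EInClique (v u : nat) : exp :=
  EOr (EEq (EVar u) (EVar v)) (EAnd (EAdj v u) (ELe (EPos v) (EPos u))).
Definition EInUnion (v w u : nat) : exp :=
  EOr (EInClique v u) (EInClique w u).
(* The double negation turns a truth value into 0 or 1. *)
Definition EUnionSize (v w : nat) : exp :=
  ESum 5 (ENot (ENot (EInUnion v w 5))).
Definition EBest (v w : nat) : exp :=
  EAll 6 (EAll 7 (ELe (EUnionSize 6 7) (EUnionSize v w))).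

(* Array false holds the adjacency matrix; array true holds, for each vertex, the
   round in which it was eliminated, counted from 1, or 0 as long as it is alive.
   The optimal pair ends up in variables 9 and 10. *)
Definition read_matrix : cmd :=
  CFor 3 (CFor 4 (CSeq (CRead 2)
    (CSeq (CStore false (EVar 1) (EVar 2))
          (CAsg 1 (EAdd (EVar 1) (ENum 1)))))).
Definition eliminate : cmd :=
  CFor 1 (CStore true (EMin 2 8 (EAnd (EAlive 8) ESimplicial))
                      (EAdd (EVar 1) (ENum 1))).
Definition choose_pair : cmd :=
  CSeq (CAsg 9 (EMin 2 8 (EEx 10 (EBest 8 10))))
       (CAsg 10 (EMin 2 8 (EBest 9 8))).
Definition print_complement : cmd :=
  CFor 1 (CIf (ENot (EInUnion 9 10 1)) (CPrint (EVar 1))).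
Definition cochain_deletion : cmd :=
  CSeq read_matrix (CSeq eliminate (CSeq choose_pair print_complement)).

(** * Values of the expressions used by the algorithm *)

Section Eval.

Variables (n : nat) (ar : bool -> nat -> nat).

Notation holds vs e := (0 < eval n vs ar e).

Lemma holds_not vs e : holds vs (ENot e) = ~~ holds vs e.
Proof. by rewrite /= subn_gt0 ltnS leqNgt. Qed.

Lemma eval_not vs e : eval n vs ar (ENot e) = ~~ holds vs e.
Proof. by rewrite /=; case: (eval _ _ _ _). Qed.

Lemma holds_or vs e1 e2 : holds vs (EOr e1 e2) = holds vs e1 || holds vs e2.
Proof. by rewrite /= addn_gt0. Qed.

Lemma holds_and vs e1 e2 : holds vs (EAnd e1 e2) = holds vs e1 && holds vs e2.
Proof. by rewrite holds_not holds_or !holds_not negb_or !negbK. Qed.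

Lemma holds_le vs e1 e2 :
  holds vs (ELe e1 e2) = (eval n vs ar e1 <= eval n vs ar e2).
Proof. by rewrite holds_not /= subn_gt0 -leqNgt. Qed.

Lemma holds_eq vs e1 e2 :
  holds vs (EEq e1 e2) = (eval n vs ar e1 == eval n vs ar e2).
Proof. by rewrite holds_and !holds_le -eqn_leq. Qed.

Lemma holds_ex vs x e :
  holds vs (EEx x e) = [exists i : 'I_n, holds (upd vs x i) e].
Proof.
rewrite /= lt0n sum_nat_eq0 negb_forall; apply: eq_existsb => i.
by rewrite implyTb lt0n.
Qed.

Lemma holds_all vs x e :
  holds vs (EAll x e) = [forall i : 'I_n, holds (upd vs x i) e].
Proof.
rewrite holds_not holds_ex negb_exists; apply: eq_forallb => i.
by rewrite holds_not negbK.
Qed.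

Lemma sum_ltn m k : \sum_(i < m) (i < k : nat) = minn k m.
Proof.
elim: m => [|m IH]; first by rewrite big_ord0 minn0.
by rewrite big_ord_recr /= IH; lia.
Qed.

(** The summand is 1 exactly at the indices below the least solution [m], so the sum is the smaller
    of [m] and n; the solution [k] keeps [m] below n. *)
Lemma eval_min vs x y e (p : pred nat) (k : 'I_n) : x != y ->
  (forall i j, holds (upd (upd vs x i) y j) e = p j) -> p k ->
  exists2 m : 'I_n, eval n vs ar (EMin x y e) = m & p m.
Proof.
move=> xy ep pk; have [m pm min_m] := ex_minnP (ex_intro [eta p] _ pk).
have ltm : m < n by apply: leq_ltn_trans (min_m _ pk) (ltn_ord k).
exists (Ordinal ltm) => //; rewrite [RHS]/= -[RHS](minn_idPl (ltnW ltm)) -sum_ltn.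
rewrite -[LHS]/(\sum_(i < n) eval n (upd vs x i) ar
  (ENot (EEx y (EAnd (ELe (EVar y) (EVar x)) e)))).
apply: eq_bigr => i _; rewrite eval_not holds_ex; congr nat_of_bool.
rewrite ltnNge; congr negb; apply/existsP/idP => [[j]|le_mi].
  rewrite holds_and holds_le ep /= {1 2}/upd eqxx /upd (negbTE xy) eqxx.
  by move=> /andP [le_ji /min_m le_mj]; apply: leq_trans le_mj le_ji.
exists (Ordinal ltm).
by rewrite holds_and holds_le ep pm andbT /= {1 2}/upd eqxx /upd (negbTE xy) eqxx.
Qed.

Definition adj (i j : nat) : bool := 0 < ar false (n * i + j).
Definition pos : nat -> nat := ar true.
Definition simp (v : nat) : bool :=
  [forall a : 'I_n, forall b : 'I_n,
    [&& pos a == 0, pos b == 0, adj v a & adj v b] ==> (a == b) || adj a b].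
Definition in_clique (v u : nat) : bool :=
  (u == v) || adj v u && (pos v <= pos u).
Definition in_union (v w u : nat) : bool := in_clique v u || in_clique w u.
Definition union_size (v w : nat) : nat := \sum_(u < n) in_union v w u.
Definition best (v w : nat) : bool :=
  [forall v' : 'I_n, forall w' : 'I_n, union_size v' w' <= union_size v w].

Lemma holds_adj vs x y : x != 0 -> holds vs (EAdj x y) = adj (vs x) (vs y).
Proof.
move=> x0; rewrite /adj /= (eq_bigr (fun=> vs x)) => [|i _].
  by rewrite sum_nat_const card_ord.
by rewrite /upd (negbTE x0).
Qed.

Lemma holds_alive vs x : holds vs (EAlive x) = (pos (vs x) == 0).
Proof. by rewrite holds_not -eqn0Ngt. Qed.

Lemma holds_simplicial vs : holds vs ESimplicial = simp (vs 8).
Proof.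
rewrite holds_all; apply: eq_forallb => a; rewrite holds_all; apply: eq_forallb => b.
rewrite !(holds_or, holds_not, holds_and, holds_alive, holds_eq, holds_adj) //.
by rewrite /upd /= implybE -!andbA.
Qed.

Lemma holds_in_clique vs v u : v != 0 ->
  holds vs (EInClique v u) = in_clique (vs v) (vs u).
Proof. by move=> v0; rewrite holds_or holds_eq holds_and holds_adj // holds_le. Qed.

Lemma holds_in_union vs v w u : v != 0 -> w != 0 ->
  holds vs (EInUnion v w u) = in_union (vs v) (vs w) (vs u).
Proof. by move=> v0 w0; rewrite holds_or !holds_in_clique. Qed.

(** The excluded variables are those the expression binds: 0 in the product inside [EAdj], 5 in the
    count. *)
Lemma eval_union_size vs v w : v \notin [:: 0; 5] -> w \notin [:: 0; 5] ->
  eval n vs ar (EUnionSize v w) = union_size (vs v) (vs w).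
Proof.
rewrite !inE !negb_or => /andP [v0 v5] /andP [w0 w5].
apply: eq_bigr => u _.
have := holds_in_union (upd vs 5 u) 5 v0 w0; rewrite /upd (negbTE v5) (negbTE w5) /=.
by rewrite -/(upd vs 5 u) => <-; case: (_ + _).
Qed.

Lemma holds_best vs v w :
  v \notin [:: 0; 5; 6; 7] -> w \notin [:: 0; 5; 6; 7] ->
  holds vs (EBest v w) = best (vs v) (vs w).
Proof.
rewrite !inE !negb_or => /and4P [v0 v5 v6 v7] /and4P [w0 w5 w6 w7].
rewrite holds_all; apply: eq_forallb => v'; rewrite holds_all.
apply: eq_forallb => w'; rewrite holds_le !eval_union_size ?inE ?negb_or ?v0 ?w0 //.
by rewrite /upd (negbTE v6) (negbTE v7) (negbTE w6) (negbTE w7).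
Qed.

End Eval.

(** * Loop invariants for reading the input and printing the answer *)

Lemma iteri_ind (T : Type) (Inv : nat -> T -> Prop) (f : nat -> T -> T) n x :
  Inv 0 x -> (forall i y, i < n -> Inv i y -> Inv i.+1 (f i y)) ->
  Inv n (iteri n f x).
Proof.
move=> H0 HS; suff H k : k <= n -> Inv k (iteri k f x) by apply: H.
by elim: k => // k IH ltk; apply: HS => //; apply/IH/ltnW.
Qed.

Lemma nth_allpairs (T1 T2 R : Type) (f : T1 -> T2 -> R) x1 x2 x s1 s2 i j :
  i < size s1 -> j < size s2 ->
  nth x [seq f y z | y <- s1, z <- s2] (size s2 * i + j) =
  f (nth x1 s1 i) (nth x2 s2 j).
Proof.
elim: s1 i => [|y s1 IH] [|i] //= lti ltj; rewrite nth_cat size_map.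
  by rewrite muln0 ltj (nth_map x2).
by rewrite mulnS -addnA ltnNge leq_addr addKn IH.
Qed.

Lemma sem_read_matrix n l :
  let s := sem n read_matrix (State (fun=> 0) (fun _ _ => 0) l [::]) in
  [/\ forall k, k < n * n -> arrs s false k = nth 0 l k,
      forall k, arrs s true k = 0 & output s = [::]].
Proof.
(* Here [m] counts all entries read so far; variable 1 is not reset between rows. *)
pose Inv m s := [/\ vars s 1 = m, input s = drop m l,
  forall k, k < m -> arrs s false k = nth 0 l k,
  forall k, arrs s true k = 0 & output s = [::]].
suff [_ _ H1 H2 H3] : Inv (n * n)
  (sem n read_matrix (State (fun=> 0) (fun _ _ => 0) l [::])) by [].
apply: (iteri_ind (Inv := fun i => Inv (i * n))).
  by rewrite mul0n; split=> //=; rewrite drop0.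
move=> i s lti Is; rewrite mulSn addnC.
apply: (iteri_ind (Inv := fun j => Inv (i * n + j))).
  by rewrite addn0; case: Is.
move=> j {Is} {}s ltj [V I A0 A1 O]; split=> //=.
- by rewrite /upd /= V addn1 addnS.
- by rewrite /upd /= I -drop1 drop_drop addnS add1n.
- move=> k; rewrite addnS ltnS leq_eqVlt /upd /= V I => /predU1P [->|ltk].
    by rewrite eqxx -nth0 nth_drop addn0.
  by rewrite (ltn_eqF ltk) A0.
Qed.

Lemma sem_print_complement n s :
  output (sem n print_complement s) = output s ++
    [seq u <- iota 0 n | ~~ in_union n (arrs s) (vars s 9) (vars s 10) u].
Proof.
pose Inv m s' := [/\ vars s' 9 = vars s 9, vars s' 10 = vars s 10,
  arrs s' = arrs s &
  output s' = output s ++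
    [seq u <- iota 0 m | ~~ in_union n (arrs s) (vars s 9) (vars s 10) u]].
suff [] : Inv n (sem n print_complement s) by [].
apply: (iteri_ind (Inv := Inv)); first by split=> //; rewrite cats0.
move=> i s' _ [V9 V10 EA EO]; set s1 := set_var s' 1 i.
change (Inv i.+1 (if 0 < eval n (vars s1) (arrs s1) (ENot (EInUnion 9 10 1))
  then sem n (CPrint (EVar 1)) s1 else s1)).
rewrite holds_not holds_in_union // [vars s1 9]V9 [vars s1 10]V10 [arrs s1]EA.
rewrite /Inv -[i.+1]addn1 iotaD filter_cat /= add0n.
case: (in_union _ _ _ _ _) => /=; split=> //=.
- by rewrite cats0.
- by rewrite EO /upd /= -cats1 catA.
Qed.

Lemma set_code_filter n (p : pred nat) :
  set_code [set u : 'I_n | p u] = [seq u <- iota 0 n | p u].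
Proof.
rewrite /set_code -val_enum_ord filter_map; congr map.
by rewrite {1}/enum_mem -enumT; apply: eq_filter => u; rewrite /= inE.
Qed.

Lemma card_in_union n ar v w :
  #|[set u : 'I_n | in_union n ar v w u]| = union_size n ar v w.
Proof.
rewrite -sum1_card big_mkcond; apply: eq_bigr => u _.
by rewrite inE; case: in_union.
Qed.

(** * Correctness of the algorithm on chordal graphs *)

Section Algorithm.

Variables (n : nat) (e : rel 'I_n).
Hypotheses (e_sym : symmetric e) (e_irrefl : irreflexive e).
Let G := SGraph e_sym e_irrefl.
Hypothesis chG : chordal G.

(** The invariant after [k] rounds. The value 0 means still alive, hence later than every round so
    far, which explains the disjunctions. By the count, a vertex is left while k < n and none when k
    = n. *)
Definition elimination (k : nat) (ps : nat -> nat) : Prop :=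
  [/\ forall v : 'I_n, ps v <= k, #|[set v : 'I_n | ps v == 0]| = n - k &
      forall v a b : 'I_n, 0 < ps v -> e v a -> e v b ->
        (ps a == 0) || (ps v <= ps a) -> (ps b == 0) || (ps v <= ps b) ->
        a != b -> e a b].

Lemma elimination_step k ps (m : 'I_n) : elimination k ps -> ps m == 0 ->
  (forall a b : 'I_n,
     ps a == 0 -> ps b == 0 -> e m a -> e m b -> a != b -> e a b) ->
  elimination k.+1 (upd ps m k.+1).
Proof.
move=> [le_k card_k cl] m0 sim.
have updm (v : 'I_n) : upd ps m k.+1 v = if v == m then k.+1 else ps v by [].
split.
- by move=> v; rewrite updm; case: eqP => // _; rewrite leqW.
- have -> : [set v : 'I_n | upd ps m k.+1 v == 0] =
      [set v : 'I_n | ps v == 0] :\ m.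
    by apply/setP => v; rewrite !inE updm; case: (v == m).
  by have := cardsD1 m [set v : 'I_n | ps v == 0]; rewrite inE m0 card_k; lia.
- move=> v a b; rewrite !updm; case: (eqVneq v m) => [->|nvm] pv va vb pa pb ab.
    (* Earlier rounds are at most [k], so a vertex not eliminated before [m] was alive when [m] was
       chosen. *)
    have alive (c : 'I_n) : ((if c == m then k.+1 else ps c) == 0)
        || (k < (if c == m then k.+1 else ps c)) -> ps c == 0.
      case: (eqVneq c m) => [-> _ //|_]; case/orP=> //.
      by rewrite ltnNge le_k.
    by apply: sim => //; apply: alive.
  (* Being alive, [m] already counted as later than [v]. *)
  have later (c : 'I_n) : ((if c == m then k.+1 else ps c) == 0)
      || (ps v <= (if c == m then k.+1 else ps c)) -> (ps c == 0) || (ps v <= ps c).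
    by case: (eqVneq c m) => [->|//]; rewrite m0.
  by apply: (cl v) => //; apply: later.
Qed.

Lemma sem_eliminate s :
  (forall i j : 'I_n, adj n (arrs s) i j = e i j) ->
  (forall k, arrs s true k = 0) ->
  let s' := sem n eliminate s in
  [/\ arrs s' false = arrs s false, elimination n (arrs s' true) &
      output s' = output s].
Proof.
move=> adjE pos0.
pose Inv k s' := [/\ arrs s' false = arrs s false, elimination k (arrs s' true) &
  output s' = output s].
apply: (iteri_ind (Inv := Inv)).
  split=> //; split=> [v||v a b]; rewrite ?pos0 // subn0.
  rewrite -[RHS]card_ord -cardsT; apply: eq_card => v.
  by rewrite !inE pos0.
move=> k s' ltk [EA [le_k card_k cl] EO].
have adjE' (i j : 'I_n) : adj n (arrs s') i j = e i j by rewrite -adjE /adj EA.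
(* This [v] only shows that the minimisation succeeds; the vertex eliminated is the least suitable
   one, [m]. *)
have [|v v0 sim_v] := @exists_simplicial G chG [set v : 'I_n | arrs s' true v == 0].
  by rewrite -card_gt0 card_k subn_gt0.
have [|||m Em /andP [m0 sim_m]] := @eval_min n (arrs s') (upd (vars s') 1 k) 2 8
  (EAnd (EAlive 8) ESimplicial)
  (fun v => (pos (arrs s') v == 0) && simp n (arrs s') v) v.
- by [].
- by move=> i j; rewrite holds_and holds_alive holds_simplicial.
- rewrite inE in v0; rewrite /pos v0; apply/forallP => a; apply/forallP => b.
  apply/implyP => /and4P [a0 b0]; rewrite !adjE' => va vb.
  have [//|ab /=] := eqVneq a b.
  by apply: sim_v => //; rewrite inE.
have Es : sem n (CStore true (EMin 2 8 (EAnd (EAlive 8) ESimplicial))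
    (EAdd (EVar 1) (ENum 1))) (set_var s' 1 k) = set_arr (set_var s' 1 k) true m k.+1.
  by rewrite -[k.+1]addn1 -Em.
change (Inv k.+1 (sem n (CStore true (EMin 2 8 (EAnd (EAlive 8) ESimplicial))
    (EAdd (EVar 1) (ENum 1))) (set_var s' 1 k))).
rewrite Es; split=> //=.
apply: elimination_step => // a b a0 b0 ma mb ab.
have /forallP/(_ a)/forallP/(_ b) := sim_m.
by rewrite /pos a0 b0 !adjE' ma mb (negbTE ab).
Qed.

(** As n > 0, some pair maximises the union size. The first minimisation finds a vertex that has an
    optimal partner, the second such a partner. *)
Lemma sem_choose_pair s : 0 < n ->
  exists v w : 'I_n, [/\ vars (sem n choose_pair s) 9 = v,
    vars (sem n choose_pair s) 10 = w & best n (arrs s) v w].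
Proof.
case: n => // n' _.
set ar := arrs s.
pose f (p : 'I_n'.+1 * 'I_n'.+1) := union_size n'.+1 ar p.1 p.2.
have [[v0 w0] _ max_f] := @arg_maxnP _ (ord0, ord0) xpredT f isT.
have best0 : best n'.+1 ar v0 w0.
  by apply/forallP => v; apply/forallP => w; apply: (max_f (v, w)).
have [|||v Ev /existsP [w1 best1]] := @eval_min n'.+1 ar (vars s) 2 8
  (EEx 10 (EBest 8 10))
  (fun v => [exists w : 'I_n'.+1, best n'.+1 ar v w]) v0.
- by [].
- by move=> i j; rewrite holds_ex; apply: eq_existsb => w; rewrite holds_best.
- by apply/existsP; exists w0.
have [|||w Ew best2] := @eval_min n'.+1 ar (upd (vars s) 9 v) 2 8 (EBest 9 8)
  (fun w => best n'.+1 ar v w) w1.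
- by [].
- by move=> i j; rewrite holds_best.
- by [].
exists v, w; split=> //.
by rewrite -Ew -Ev.
Qed.

Lemma elimination_clique (ar : bool -> nat -> nat) :
  (forall i j : 'I_n, adj n ar i j = e i j) -> elimination n (ar true) ->
  forall v : 'I_n, clique (G := G) [set u : 'I_n | in_clique n ar v u].
Proof.
move=> adjE [le_n card_n cl] v a b; rewrite !inE /in_clique !adjE !val_eqE.
(* No vertex is alive after n rounds, so the third clause of [elimination] applies to every [v]. *)
have pos_gt0 (c : 'I_n) : 0 < ar true c.
  rewrite lt0n; apply/negP => c0; move/eqP: card_n; rewrite subnn cards_eq0.
  by move=> /eqP/setP/(_ c); rewrite !inE c0.
move=> /predU1P [->|/andP [va pa]] /predU1P [->|/andP [vb pb]] ab //=.
- by rewrite eqxx in ab.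
- by rewrite e_sym.
- by apply: (cl v); rewrite ?pa ?pb ?orbT.
Qed.

(** The member of [A] eliminated first serves; [v0] is a default for the empty clique. *)
Lemma clique_elimination (ar : bool -> nat -> nat) (A : {set G}) (v0 : 'I_n) :
  (forall i j : 'I_n, adj n ar i j = e i j) -> clique A ->
  exists v : 'I_n, {in A, forall u, in_clique n ar v (u : 'I_n)}.
Proof.
move=> adjE cA; have [->|/set0Pn [a aA]] := eqVneq A set0.
  by exists v0 => u; rewrite inE.
have [v vA min_v] := @arg_minnP _ a (mem A) (fun u : 'I_n => pos ar u) aA.
exists v => u uA; rewrite /in_clique adjE min_v // andbT.
case: (eqVneq (u : G) v) => [->|uv]; first by rewrite eqxx.
by have -> : e v u; [apply: (cA v u vA uA); rewrite eq_sym | rewrite orbT].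
Qed.

Lemma cochain_deletion_correct (l : seq nat) :
  l = [seq nat_of_bool (e i j) | i <- enum 'I_n, j <- enum 'I_n] ->
  exists S : {set 'I_n}, minimum_deletion_set cochain_graph (G := G) S /\
    output (sem n cochain_deletion (State (fun=> 0) (fun _ _ => 0) l [::])) =
    set_code S.
Proof.
move=> El; have := sem_read_matrix n l; set s0 := State _ _ _ _.
have -> : sem n cochain_deletion s0 =
  sem n print_complement (sem n choose_pair (sem n eliminate (sem n read_matrix s0)))
  by [].
set s1 := sem n read_matrix _ => -[A1 P1 O1].
have adj1 (i j : 'I_n) : adj n (arrs s1) i j = e i j.
  rewrite /adj A1; last by have := ltn_ord i; have := ltn_ord j; nia.
  rewrite El -[X in X * i](size_enum_ord n) (nth_allpairs _ i j) ?size_enum_ord //.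
  by rewrite !nth_ord_enum; case: (e i j).
have [A2 el2 O2] := sem_eliminate adj1 P1.
set s2 := sem n eliminate s1 in A2 el2 O2 *.
have adj2 (i j : 'I_n) : adj n (arrs s2) i j = e i j by rewrite -adj1 /adj A2.
have A3 : arrs (sem n choose_pair s2) = arrs s2 by [].
have O3 : output (sem n choose_pair s2) = output s2 by [].
rewrite sem_print_complement A3 O3 O2 O1 cat0s.
set v := vars _ 9; set w := vars _ 10.
exists [set u : 'I_n | ~~ in_union n (arrs s2) v w u]; split; last first.
  exact/esym/(set_code_filter n (fun u => ~~ in_union n (arrs s2) v w u)).
(* Without vertices there is no pair to choose, and every set is empty. *)
have [n0|n_gt0] := posnP n.
  have no (x : 'I_n) : False by case: x => k; rewrite n0.
  split=> [|S' _]; last by rewrite eq_card0 // => x; case: (no x).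
  by apply: (cliques_deletion_set (A := set0) (B := set0) chG);
    try apply/subsetP; move=> x; case: (no x).
have [v1 [w1 [Ev Ew best_vw]]] := sem_choose_pair s2 n_gt0.
rewrite -/v -/w in Ev Ew; rewrite Ev Ew.
have compl_union (v' w' : 'I_n) :
    ~: [set u : 'I_n | ~~ in_union n (arrs s2) v' w' u] =
    [set u : 'I_n | in_clique n (arrs s2) v' u] :|:
    [set u : 'I_n | in_clique n (arrs s2) w' u].
  by apply/setP => u; rewrite !inE negbK.
split.
  apply: (cliques_deletion_set (G := G)
    (A := [set u : 'I_n | in_clique n (arrs s2) v1 u])
    (B := [set u : 'I_n | in_clique n (arrs s2) w1 u])) => //.
  - exact: elimination_clique.
  - exact: elimination_clique.
  - by rewrite compl_union.
move=> S' /deletion_set_cliques [A [B [cA cB ES]]].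
have [v' Av'] := clique_elimination v1 adj2 cA.
have [w' Bw'] := clique_elimination v1 adj2 cB.
(* Adding the size of [~: S'] to both sides turns the minimality of the deleted set into the
   maximality of what remains. *)
rewrite -(leq_add2r #|~: S'|) cardsC.
rewrite -(cardsC [set u : 'I_n | ~~ in_union n (arrs s2) v1 w1 u]) leq_add2l.
have -> : ~: [set u : 'I_n | ~~ in_union n (arrs s2) v1 w1 u] =
    [set u : 'I_n | in_union n (arrs s2) v1 w1 u].
  by apply/setP => u; rewrite !inE negbK.
rewrite card_in_union.
(* The cliques of [v'] and [w'] cover what [S'] leaves, and their union is at most the optimal
   one. *)
have /forallP/(_ v')/forallP/(_ w') := best_vw; apply: leq_trans.
rewrite -card_in_union ES; apply: subset_leq_card; apply/subsetP => u.
by rewrite !inE /in_union => /orP [/Av' ->|/Bw' ->]; rewrite ?orbT.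
Qed.

End Algorithm.

Theorem theorem6 : polytime_deletion chordal cochain_graph.
Proof.
(* The constant 1 pays for the initial [Read 0]. *)
exists (machine cochain_deletion), (1%:P + ccost cochain_deletion)%R.
move=> n e e_sym e_irrefl G chG.
have [S [minS outS]] := cochain_deletion_correct chG (erefl _).
by exists S; split=> //; rewrite -outS; apply: machine_correct.
Qed.
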